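(* Let $G$ be a compact metrisable abelian topological group (written additively), let $(\Omega,\mathcal{F},P)$ be a probability space, and let $X,Y:\Omega\to G$ be independent random variables such that $X\sim X+Y$. Then there exists a compact subgroup $A\subset G$ such that $P(Y\in A)=1$ and $X\sim X+a$ for each $a\in A$.
   Context: A random variable with values in a topological space $G$ is a map $X:\Omega\to G$ such that $X^{-1}(B)$ is measurable for every Borel set $B\subset G$. Its distribution is the Borel probability measure $\mu_X(B)=P(X\in B)$ on $G$. For $G$-valued random variables $X,Z$, $X\sim Z$ means that they have the same distribution, i.e. $\mu_X=\mu_Z$. *)

(* Defs.v *)
From HB Require Import structures.
From mathcomp Require Import all_boot all_order all_algebra.
From mathcomp Require Import all_classical all_reals all_analysis.

Set Implicit Arguments.
Unset Strict Implicit.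
Unset Printing Implicit Defensive.

Import Order.TTheory GRing.Theory Num.Theory.

Local Open Scope classical_set_scope.
Local Open Scope ring_scope.

(* The metric is required to induce the given topology of [T]. *)
Definition metrizable (R : realType) (T : topologicalType) : Prop :=
  exists d : T -> T -> R,
    [/\ forall x y, 0 <= d x y,
        forall x y, d x y = 0 <-> x = y,
        forall x y, d x y = d y x,
        forall x y z, d x z <= d x y + d y z &
        forall (x : T) (A : set T),
          nbhs x A <-> exists2 e : R, 0 < e & [set y | d x y < e] `<=` A].

(* The group [G] equipped with its Borel sigma-algebra. Measurable types are
   pointed in the library; the point chosen here is 0. *)
Definition borel (G : topologicalZmodType) : Type := G.

Section borel_instances.
Variable G : topologicalZmodType.

HB.instance Definition _ := TopologicalZmodule.on (borel G).
HB.instance Definition _ := isPointed.Build (borel G) (0 : G).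
HB.instance Definition _ := @isMeasurable.Build (sigma_display (@open G))
  (borel G) <<s @open G >> (@sigma_algebra0 _ setT (@open G))
  (@sigma_algebraC (borel G) (@open G))
  (@sigma_algebra_bigcup _ setT (@open G)).

End borel_instances.

Section random_variables.
Context (d d' : measure_display) (Omega : measurableType d)
  (T : measurableType d') (R : realType) (P : probability Omega R).

(* Distributions are compared on measurable sets only: [pushforward P X]
   is a total function, whose values on other sets are irrelevant.
   The arguments are bare functions so that sums can be compared without
   bundling a measurability proof. *)
Definition same_distribution (X Z : Omega -> T) : Prop :=
  forall B : set T, measurable B -> pushforward P X B = pushforward P Z B.

Definition independent_rv (X Y : {RV P >-> T}) : Prop :=
  forall A B : set T, measurable A -> measurable B ->
    P (X @^-1` A `&` Y @^-1` B) = (P (X @^-1` A) * P (Y @^-1` B))%E.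

End random_variables.

(* Main.v *)
Require Import Defs.
From HB Require Import structures.
From mathcomp Require Import all_boot all_order all_algebra.
From mathcomp Require Import finmap.
From mathcomp Require Import all_classical all_reals all_analysis.
From mathcomp Require Import measurable_realfun.

Set Implicit Arguments.
Unset Strict Implicit.
Unset Printing Implicit Defensive.

Import Order.TTheory GRing.Theory Num.Theory.
Import numFieldNormedType.Exports.

Local Open Scope classical_set_scope.
Local Open Scope ring_scope.

(** Write [mu] and [nu] for the laws of [X] and [Y], and let [f] be a continuous
real function on [G]. The mean [h g := E f (X + g)] is continuous in [g], and
since [X] and [X + Y] have the same law and [Y] is independent of [X], it
satisfies the mean value property [h g = E h (Y + g)]. Call such a function
harmonic for [nu].

The heart of the proof is a discrete Liouville theorem of Choquet-Deny type
([harmonic_shift]): a continuous harmonic function [h] on a compact abelian group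
is invariant under every point [z] of the support of [nu]. Because the group is
abelian, [D g := h g - h (g + z)] is again harmonic. By compactness it has
a maximum [M], at [g0] say, and a mean of values not exceeding [M] can only equal
[M] if all values on the support do ([harmonic_argmax]); so [D] equals [M] at
[g0 + z], hence at all [g0 + n z]. Telescoping gives
[h g0 - h (g0 + n z) = n M], and [h] is bounded, so [M <= 0]. The same argument
for [- h] yields the reverse inequality.

The subgroup sought is the set [A] of the [a] such that [E f (X + a) = E f X] for
all continuous [f]. It is closed, hence compact, and it contains the support of
[nu]; as [G] is second countable the support carries all the mass of [nu], so
[P (Y \in A) = 1]. Finally, on a metrizable compact space the integrals of
continuous functions determine a Borel probability ([probability_eq_continuous]),
which turns the definition of [A] into the equality of the laws of [X] and
[X + a].

Second countability is also what makes addition measurable for the product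
sigma-algebra of [borel G * borel G], so that [X + Y] has a law and Fubini's
theorem applies. *)

(** * Metrizable spaces *)

(** A countable base of the topology, presented as a sequence so that unions
over it are directly countable unions of measurable sets. *)
Definition base_seq (T : topologicalType) (U : (set T)^nat) : Prop :=
  (forall n, open (U n)) /\
  forall x A, nbhs x A -> exists n, U n x /\ U n `<=` A.

(** The base consists, for each [n], of the interiors of finitely many balls of
radius [1 / (n + 1)] covering the space. *)
Lemma metrizable_base_seq (R : realType) (T : ptopologicalType) :
  compact [set: T] -> metrizable R T -> exists U : (set T)^nat, base_seq U.
Proof.
move=> cT [d [d_ge0 d_eq0 d_sym d_tri d_nbhs]].
pose f n (z : T) : set T := [set y | d z y < n.+1%:R^-1]°.
have f_self n z : f n z z.
  by rewrite /f /interior /= d_nbhs; exists n.+1%:R^-1.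
have cov n : finite_subset_cover [set: T] (f n) [set: T].
  move: cT; rewrite compact_cover; apply.
  - by move=> z _; exact: open_interior.
  - by move=> z _; exists z.
pose h n := projT1 (cid (iffLR (exists2P _ _) (cov n))).
have hP n (x : T) : exists2 w : T, w \in h n & f n w x.
  by have [_ /(_ x) [// | w ? ?]] := projT2 (cid (iffLR (exists2P _ _) (cov n)));
    exists w.
pose B := \bigcup_n (f n) @` [set` h n].
have cB : countable B.
  apply: bigcup_countable => // n _; apply: finite_set_countable.
  exact/finite_image/finite_fset.
have oB V : B V -> open V by move=> [n _ [z _ <-]]; exact: open_interior.
have bB x A : nbhs x A -> exists V, [/\ B V, V x & V `<=` A].
  move=> /d_nbhs [e e0 eA].
  have [n] := @ltr_add_invr R 0 (e / 2) (divr_gt0 e0 (ltr0Sn R 1)); rewrite add0r => ne.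
  have [w wh fx] := hP n x.
  exists (f n w); split => //; first by exists n => //; exists w.
  move=> y /interior_subset /= wy; apply: eA => /=.
  have /interior_subset /= wx := fx.
  rewrite (le_lt_trans (d_tri _ w _))// (splitr e) ltrD// ?(lt_trans wy)//.
  by rewrite d_sym (lt_trans wx).
(* An empty [B] has no enumeration by [nat], but it contradicts [bB]. *)
have [B0|[s]] := (pfcard_geP cB).
  exists (fun=> setT); split => [n|x A]; first exact: openT.
  by move=> /bB [V []]; rewrite B0.
exists s; split=> [n|x A /bB [V [BV Vx VA]]].
  by apply: oB; exact: funS.
by have [n _ nV] := @surj _ _ _ _ s _ BV; exists n; rewrite nV.
Qed.

(** The function is the distance to the complement of [O]; when the complement
is empty that infimum is meaningless and the constant 1 is used instead. *)
Lemma metrizable_positivity_set (R : realType) (T : topologicalType) (O : set T) :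
  metrizable R T -> open O ->
  exists phi : T -> R, [/\ continuous phi, forall x, 0 <= phi x &
    forall x, O x <-> 0 < phi x].
Proof.
move=> [d [d_ge0 d_eq0 d_sym d_tri d_nbhs]] oO.
have [[y0 Oy0]|/forallNP allO] := pselect (exists y, ~ O y); last first.
  exists (cst 1); split => // [x|x]; first exact: cvg_cst.
  by split => // _; apply: contrapT; exact: allO.
pose D x := [set d x y | y in ~` O].
have D0 x : D x !=set0 by exists (d x y0), y0.
have lbD x : lbound (D x) 0 by move=> _ [y _ <-].
have infD x y : ~ O y -> inf (D x) <= d x y.
  by move=> Oy; apply: ge_inf; [exists 0|exists y].
have lip x x' : inf (D x) <= inf (D x') + d x x'.
  rewrite -lerBlDr; apply: lb_le_inf => // _ [y Oy <-].
  by rewrite lerBlDr addrC (le_trans (infD x y Oy))// d_tri.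
exists (fun x => inf (D x)); split => [x|x|x].
- apply/cvgrPdist_le => e e0; apply/d_nbhs; exists e => // x' /= /ltW xx'.
  rewrite ler_distl lerBlDr; apply/andP; split.
    by rewrite (le_trans (lip x' x))// lerD2l d_sym.
  by rewrite (le_trans (lip x x'))// lerD2l.
- exact: lb_le_inf.
split=> [Ox|Dx]; last first.
  apply: contrapT => /infD => /(_ x).
  by rewrite (d_eq0 x x).2// leNgt Dx.
have /d_nbhs[e e0 eO] := open_nbhs_nbhs (conj oO Ox).
apply: (lt_le_trans e0); apply: lb_le_inf => // _ [y Oy <-].
by rewrite leNgt; apply/negP => /eO.
Qed.

(** * Borel functions on a compact group *)

Section borel.
Context (R : realType) (G : topologicalZmodType).
Implicit Types (mu nu : probability (borel G) R) (f : borel G -> R).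

Lemma open_borel (A : set (borel G)) : open A -> measurable A.
Proof. by move=> oA; exact: sub_sigma_algebra. Qed.

Lemma continuous_borel f : continuous f -> measurable_fun setT f.
Proof.
move=> /continuousP cf; apply: (measurability _ (RGenOpens.measurableE R)).
move=> _ [_ [a [b ->] <-]]; rewrite setTI; apply: open_borel.
exact/cf/interval_open.
Qed.

(** A product of Borel sigma-algebras may be smaller than the Borel
sigma-algebra of the product; with a countable base, the open set
[x + y \in A] is a countable union of open rectangles, hence measurable. *)
Lemma add_borel_measurable (U : (set G)^nat) : base_seq U ->
  measurable_fun setT (fun p : borel G * borel G => p.1 + p.2 : borel G).
Proof.
move=> [oU bU]; apply: (@measurability _ _ _ (borel G) _ _ (@open G)) => [//|].
move=> _ [A oA <-]; rewrite setTI.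
rewrite (_ : _ @^-1` _ = \bigcup_i \bigcup_j
  (if pselect (forall x y, U i x -> U j y -> A (x + y)) then U i `*` U j
   else set0)); last first.
  apply/seteqP; split => [[x y] /= Axy|[x y] [i _ [j _]]]; last first.
    by case: pselect => //= UA [/= ux uy]; exact: UA.
  have := @add_continuous G (x, y) A (open_nbhs_nbhs (conj oA Axy)).
  case=> -[V W] /= [/bU[i [Uix UiV]] /bU[j [Ujy UjW]]] VWA.
  exists i => //; exists j => //; case: pselect => //=; case=> x' y' ix jy.
  by apply: (VWA (x', y')); split; [exact: UiV|exact: UjW].
apply: bigcupT_measurable => i; apply: bigcupT_measurable => j.
by case: pselect => _ /=; [apply: measurableX; exact: open_borel|].
Qed.

Hypothesis cG : compact [set: G].

Lemma continuous_comp_integrable d (T : measurableType d)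
    (P : probability T R) (f : borel G -> R) (Z : T -> borel G) :
  continuous f -> measurable_fun setT Z ->
  P.-integrable setT (EFin \o (f \o Z)).
Proof.
move=> cf mZ; apply: measurable_bounded_integrable => //.
- by rewrite ltey_eq fin_num_measure.
- by apply: measurableT_comp mZ; exact: continuous_borel.
- have := @continuous_compact (borel G) R f setT (continuous_subspaceT cf) cG.
  move=> /compact_bounded[M [_ mrt]].
  exists M; split; rewrite ?num_real // => r Mr x _; apply: mrt Mr _ _.
  by exists (Z x).
Qed.

Lemma continuous_integrable mu f : continuous f ->
  mu.-integrable setT (EFin \o f).
Proof.
by move=> cf; exact: (@continuous_comp_integrable _ _ mu f id).
Qed.

Definition shift_mean mu f (g : G) : R := \int[mu]_x f (x + g).

Lemma continuous_shift f (g : G) : continuous f -> continuous (fun x => f (x + g)).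
Proof.
move=> cf x; apply: continuous_comp; last exact: cf.
apply: (@continuous_comp _ _ _ (fun x => (x, g)) (fun p : G * G => p.1 + p.2)).
  by apply: cvg_pair; [exact: cvg_id|exact: cvg_cst].
exact: add_continuous.
Qed.

(** Uniform continuity: by compactness, [f (x + g')] is close to [f (x + g)] for
all [x] at once as soon as [g'] is close to [g]. *)
Lemma continuous_shift_mean mu f : continuous f -> continuous (shift_mean mu f).
Proof.
move=> cf g; apply/cvgrPdist_le => e e0.
have unif : \forall g' \near g, [set: G] `<=`
    (fun x => `|f (x + g) - f (x + g')| <= e).
  apply: (compact_near_coveringP _).1 => // x _.
  have ct : continuous (fun p : G * G => `|f (p.1 + g) - f (p.1 + p.2)|).
    move=> p; apply: cvg_norm; apply: cvgB.
      apply: (@continuous_comp _ _ _ fst (fun x => f (x + g))).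
        exact: cvg_fst.
      exact: continuous_shift.
    apply: (@continuous_comp _ _ _ (fun p : G * G => p.1 + p.2) f).
      exact: add_continuous.
    exact: cf.
  have := ct (x, g); rewrite /continuous_at /= subrr normr0.
  move=> /cvgrPdist_le /(_ _ e0).
  by apply: filterS => p /=; rewrite sub0r normrN normr_id.
apply: filterS unif => g' unif.
rewrite -RintegralB//; [|exact/continuous_integrable/continuous_shift..].
apply: le_trans (le_normr_Rintegral _ _) _ => //.
  apply/continuous_integrable => x.
  by apply: continuousB; exact: continuous_shift.
apply: (@le_trans _ _ (\int[mu]_x (cst e x))).
  apply: le_Rintegral => //.
  - apply: continuous_integrable => x.
    by apply: cvg_norm; apply: cvgB; exact: continuous_shift.
  - by apply: continuous_integrable => x; exact: cvg_cst.
rewrite (@Rintegral_cst _ _ _ mu)//= [X in _ * fine X](probability_setT mu).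
by rewrite mulr1.
Qed.

End borel.

(** * Harmonic functions on a compact abelian group *)

Section harmonic.
Context (R : realType) (G : topologicalZmodType).
Implicit Types (mu nu : probability (borel G) R) (f h : borel G -> R).
Hypothesis cG : compact [set: G].

Definition in_support nu (z : G) : Prop :=
  forall U : set (borel G), open U -> U z -> nu U != 0%E.

Definition harmonic nu h : Prop := forall g, shift_mean nu h g = h g.

(** Maximum principle: [u x = h g - h (x + g)] is nonnegative with
[nu]-integral 0, hence [nu]-almost everywhere 0, so the open set where it is
nonzero is null and misses the support. *)
Lemma harmonic_argmax nu h (g z : G) : continuous h -> harmonic nu h ->
  in_support nu z -> (forall x, h x <= h g) -> h (z + g) = h g.
Proof.
move=> ch hh nuz hmax.
pose u x := h g - h (x + g).
have cu : continuous u.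
  by move=> x; apply: cvgB; [exact: cvg_cst|exact: continuous_shift].
have iu := continuous_integrable cG nu cu.
have u0 : (\int[nu]_x (u x)%:E = 0)%E.
  rewrite -(fineK (integrable_fin_num _ iu))//; congr EFin.
  have -> : fine (\int[nu]_x (u x)%:E)%E = \int[nu]_x (cst (h g) x - h (x + g)).
    by [].
  rewrite RintegralB//; last 2 first.
  - by apply: continuous_integrable => // x; exact: cvg_cst.
  - by apply: continuous_integrable => //; exact: continuous_shift.
  rewrite (@Rintegral_cst _ _ _ nu)//= [X in _ * fine X](probability_setT nu).
  rewrite mulr1; apply/eqP; rewrite subr_eq0; apply/eqP.
  exact/esym/hh.
have [N [mN N0 Nu]] : ae_eq nu setT (EFin \o u) (cst 0%E).
  apply/ae_eq_integral_abs => //; first exact: measurable_int iu.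
  rewrite -[RHS]u0; apply: eq_integral => x _ /=.
  by rewrite ger0_norm// subr_ge0.
pose U := u @^-1` [set r | r != 0].
have oU : open U.
  by apply: open_comp => [x _|]; [exact: cu|exact: open_neq].
apply/eqP; apply: contraT => uz.
have := nuz U oU; rewrite /U /= /u subr_eq0 eq_sym => /(_ uz).
apply: contra_neqT => _; apply: (subset_measure0 _ _ _ N0) => //.
  exact: open_borel.
by apply: subset_trans Nu => x /= /eqP ux /(_ I) [].
Qed.

(** The maximum principle is iterated on the increment [D x = h x - h (x + z)],
which is harmonic because translations commute. *)
Lemma harmonic_le_shift nu h (g z : G) : continuous h -> harmonic nu h ->
  in_support nu z -> h g <= h (g + z).
Proof.
move=> ch hh nuz.
pose D x := h x - h (x + z).
have cD : continuous D.
  by move=> x; apply: cvgB; [exact: ch|exact: continuous_shift].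
have hD : harmonic nu D.
  move=> x; rewrite /shift_mean /D RintegralB//; last 2 first.
  - by apply: continuous_integrable => //; exact: continuous_shift.
  - apply: continuous_integrable => //.
    by apply: (@continuous_shift R G (fun x => h (x + z))); exact: continuous_shift.
  congr (_ - _); first exact: hh.
  by under eq_Rintegral do rewrite -addrA; exact: hh.
have G0 : [set: borel G] !=set0 by exists 0.
have [g0 _ D_max] := compact_EVT_max G0 cG (continuous_subspaceT cD).
have [c _ h_min] := compact_EVT_min G0 cG (continuous_subspaceT ch).
suff Dg0 : D g0 <= 0.
  by rewrite -subr_le0; apply: le_trans Dg0; apply: D_max; rewrite inE.
rewrite leNgt; apply/negP => Dg0.
have Dn n : D (z *+ n + g0) = D g0.
  elim: n => [|n IH]; first by rewrite mulr0n add0r.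
  rewrite mulrS -addrA -[RHS]IH; apply: (@harmonic_argmax nu) => //.
  by move=> x; rewrite IH D_max// inE.
have hn n : h g0 - h (z *+ n + g0) = D g0 *+ n.
  elim: n => [|n IH]; first by rewrite mulr0n mulr0n add0r subrr.
  rewrite [RHS]mulrS -IH -(Dn n) /D.
  have -> : z *+ n.+1 + g0 = z *+ n + g0 + z by rewrite mulrS -addrA addrC.
  by rewrite addrC subrKA.
(* A number [n] of steps for which [n * D g0] exceeds the oscillation of [h]. *)
have := truncnS_gt ((h g0 - h c) / D g0).
rewrite ltr_pdivrMr// mulrC mulr_natr -hn ltrD2l ltrN2 ltNge.
by rewrite h_min// inE.
Qed.

Lemma harmonic_shift nu h (g z : G) : continuous h -> harmonic nu h ->
  in_support nu z -> h (g + z) = h g.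
Proof.
move=> ch hh nuz; apply/eqP; rewrite eq_le (@harmonic_le_shift nu h g z)// andbT.
rewrite -lerN2; apply: (@harmonic_le_shift nu (fun x => - h x)) => //.
  by move=> x; apply: cvgN; exact: ch.
move=> x; rewrite -[in RHS](hh x) /shift_mean -mulN1r -RintegralZl//; last first.
  by apply: continuous_integrable => //; exact: continuous_shift.
by under [RHS]eq_Rintegral do rewrite mulN1r.
Qed.

End harmonic.

(** * Probabilities on a compact metrizable group *)

Section borel_probability.
Context (R : realType) (G : topologicalZmodType).
Implicit Types (mu nu : probability (borel G) R).
Hypotheses (cG : compact [set: G]) (mG : metrizable R G).

(** Open sets form a pi-system generating the Borel sets, and the indicator of
an open set [O] is the increasing limit of the continuous functions
[min 1 (n phi)], where [phi] is positive exactly on [O]. *)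
Lemma probability_eq_continuous mu nu :
  (forall f : borel G -> R, continuous f -> \int[mu]_x f x = \int[nu]_x f x) ->
  forall B, measurable B -> mu B = nu B.
Proof.
move=> munu.
apply: (@measure_unique _ _ (borel G) (@open G) (fun=> setT)) => //.
- by move=> A B oA oB; exact: openI.
- by move=> _; exact: openT.
- by rewrite bigcup_const//; exists 0%N.
- move=> O oO.
  have [phi [cphi phi0 phiO]] := metrizable_positivity_set mG oO.
  pose f n (x : borel G) : R := Num.min 1 (n%:R * phi x).
  have cf n : continuous (f n).
    move=> x; apply: (@continuous_min R (borel G) (cst 1) (fun x => n%:R * phi x)).
      exact: cvg_cst.
    by apply: cvgM; [exact: cvg_cst|exact: cphi].
  have f_lim x : (f n x)%:E @[n --> \oo] --> (\1_O x)%:E.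
    apply: cvg_near_cst; rewrite indicE; have [Ox|Ox] := boolP (x \in O).
      have phix : 0 < phi x by apply/phiO; rewrite -in_setE.
      near=> n; congr EFin; apply/min_idPl.
      rewrite -ler_pdivrMr// (le_trans (ltW (truncnS_gt _)))// ler_nat.
      by near: n; exact: nbhs_infty_ge.
    have phix0 : phi x = 0.
      apply/eqP; rewrite eq_le phi0 andbT leNgt; apply: contra Ox => phix.
      by rewrite in_setE; exact/phiO.
    by apply: nearW => n; rewrite /f phix0 mulr0 min_r.
  have lim_int (m : probability (borel G) R) :
      (\int[m]_x (f n x)%:E)%E @[n --> \oo] --> m O.
    have -> : m O = (\int[m]_x (\1_O x)%:E)%E.
      by rewrite integral_indic ?setIT//; exact: open_borel.
    under eq_integral do rewrite -(cvg_lim _ (f_lim _))//.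
    apply: cvg_monotone_convergence => //.
    - by move=> n; apply/measurable_EFinP; exact: continuous_borel.
    - by move=> n x _; rewrite lee_fin le_min ler01 mulr_ge0.
    - move=> x _ n k nk; rewrite lee_fin le_min ge_min lexx/=.
      by rewrite ge_min ler_wpM2r ?orbT// ler_nat.
  apply: (cvg_unique _ (lim_int mu)) => //.
  suff -> : (fun n => \int[mu]_x (f n x)%:E)%E =
            (fun n => \int[nu]_x (f n x)%:E)%E by exact: lim_int.
  apply/funext => n.
  rewrite -(fineK (integrable_fin_num _ (continuous_integrable cG mu (cf n))))//.
  rewrite -(fineK (integrable_fin_num _ (continuous_integrable cG nu (cf n))))//.
  congr EFin; exact: munu.
- by move=> _; rewrite ltey_eq fin_num_measure.
Unshelve. all: by end_near. Qed.

(** The complement of the support is covered by the null sets of a countable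
base. *)
Lemma support_negligible (U : (set G)^nat) nu : base_seq U ->
  nu.-negligible [set z : borel G | ~ in_support nu z].
Proof.
move=> [oU bU].
have N : nu.-negligible (\bigcup_n
    (if pselect (nu (U n) = 0%E) then U n else set0) : set (borel G)).
  apply: negligible_bigcup => n; case: pselect => [U0|_] /=.
    by exists (U n); split => //; exact: open_borel.
  exact: negligible_set0.
apply: negligibleS N => z /=.
move=> /existsNP[V /not_implyP[oV /not_implyP[Vz /negP/negPn/eqP V0]]].
have [n [Unz UV]] := bU z V (open_nbhs_nbhs (conj oV Vz)).
exists n => //; case: pselect => //=; case.
apply/eqP; rewrite -measure_le0 -V0; apply: le_measure => //; rewrite inE;
  exact: open_borel.
Qed.

End borel_probability.

(** * Sums of independent random variables *)

Section random_sum.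
Context (R : realType) (d : measure_display) (Omega : measurableType d)
  (P : probability Omega R) (G : topologicalZmodType).
Hypotheses (cG : compact [set: G]) (mG : metrizable R G).

Lemma compact_metrizable_base_seq : exists U : (set G)^nat, base_seq U.
Proof. exact: (@metrizable_base_seq R (borel G)). Qed.

Lemma independent_joint_law (X Y : {RV P >-> borel G})
    (mXY : measurable_fun setT (fun w => (X w, Y w))) (A : set _) :
  independent_rv X Y -> measurable A ->
  pushforward P (fun w => (X w, Y w)) A =
  (distribution P X \x distribution P Y)%E A.
Proof.
move=> XY mA.
pose Z : {mfun Omega >-> (borel G * borel G)%type} :=
  HB.pack (fun w => (X w, Y w)) (isMeasurableFun.Build _ _ _ _ _ mXY).
exact/esym/(@product_measure_unique _ _ _ _ _ _ _ (distribution P Z)).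
Qed.

Lemma sum_measurable (X Y : {RV P >-> borel G}) :
  measurable_fun setT (fun w => X w + Y w : borel G).
Proof.
have [U bU] := compact_metrizable_base_seq.
have mXY : measurable_fun setT (fun w => (X w, Y w)) by exact: measurable_fun_pair.
exact: (measurableT_comp (add_borel_measurable bU) mXY).
Qed.

(** By independence the law of [(X, Y)] is a product measure, and Fubini's theorem
allows [X] to be averaged first. *)
Lemma independent_sum_integral (X Y : {RV P >-> borel G}) (f : borel G -> R) :
  independent_rv X Y -> continuous f ->
  \int[P]_w f (X w + Y w) =
  \int[distribution P Y]_y shift_mean (distribution P X) f y.
Proof.
move=> XY cf.
have [U bU] := compact_metrizable_base_seq.
have mXY : measurable_fun setT (fun w => (X w, Y w)) by exact: measurable_fun_pair.
pose Z : {mfun Omega >-> (borel G * borel G)%type} :=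
  HB.pack (fun w => (X w, Y w)) (isMeasurableFun.Build _ _ _ _ _ mXY).
pose F (p : borel G * borel G) : \bar R := (f (p.1 + p.2))%:E.
have mF : measurable_fun setT F.
  apply/measurable_EFinP; apply: (measurableT_comp (continuous_borel cf)).
  exact: add_borel_measurable bU.
have iFX : (distribution P X \x distribution P Y)%E.-integrable setT F.
  exact: (continuous_comp_integrable cG _ cf (add_borel_measurable bU)).
transitivity (fine (\int[distribution P Z]_p F p)%E).
  rewrite /Rintegral integral_distribution//.
  exact: (continuous_comp_integrable cG _ cf (sum_measurable X Y)).
transitivity (fine (\int[distribution P X \x distribution P Y]_p F p)%E).
  congr fine; apply: eq_measure_integral => A mA _.
  exact: independent_joint_law.
rewrite -integral21_prod_meas1// /Rintegral; congr fine.
apply: eq_integral => y _; rewrite /shift_mean /Rintegral fineK//.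
apply: integrable_fin_num => //.
by apply: continuous_integrable => //; exact: continuous_shift.
Qed.

Lemma law_Rintegral (Z : {mfun Omega >-> borel G}) (f : borel G -> R) :
  continuous f -> \int[distribution P Z]_x f x = \int[P]_w f (Z w).
Proof.
move=> cf; congr fine; rewrite integral_distribution//.
  by apply/measurable_EFinP; exact: continuous_borel.
exact: (continuous_comp_integrable cG _ cf (measurable_funP Z)).
Qed.

Lemma law_shift_mean (Z : {mfun Omega >-> borel G}) (f : borel G -> R) (a : G) :
  continuous f -> \int[P]_w f (Z w + a) = shift_mean (distribution P Z) f a.
Proof.
by move=> cf; rewrite /shift_mean -(law_Rintegral Z (continuous_shift cf)).
Qed.

(** Replacing [X] by [X + Y] in [E f (X + g)] does not change its value, but adds
an average over [Y]. *)
Lemma shift_mean_harmonic (X Y : {RV P >-> borel G}) (f : borel G -> R) :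
  independent_rv X Y -> same_distribution P X (fun w => X w + Y w) ->
  continuous f ->
  harmonic (distribution P Y) (shift_mean (distribution P X) f).
Proof.
move=> XY XXY cf g.
have cfg := continuous_shift (g := g) cf.
pose S : {mfun Omega >-> borel G} := HB.pack (fun w => X w + Y w : borel G)
  (isMeasurableFun.Build _ _ _ _ _ (sum_measurable X Y)).
transitivity (\int[distribution P Y]_y
    shift_mean (distribution P X) (fun x => f (x + g)) y).
  by apply: eq_Rintegral => y _; apply: eq_Rintegral => x _; rewrite addrA.
rewrite -independent_sum_integral// -(law_Rintegral S cfg).
congr fine; apply: eq_measure_integral => A mA _.
exact/esym/XXY.
Qed.

End random_sum.

(** * The stabilizer of a probability *)

Section stabilizer.
Context (R : realType) (G : topologicalZmodType).
Implicit Types mu : probability (borel G) R.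
Hypothesis cG : compact [set: G].

(** The translations that preserve [mu], tested on continuous functions so that
the set is visibly closed. *)
Definition stabilizer mu : set G :=
  [set a | forall f, continuous f -> shift_mean mu f a = shift_mean mu f 0].

Lemma stabilizer_closed mu : closed (stabilizer mu).
Proof.
rewrite (_ : stabilizer mu = \bigcap_(f in [set f | continuous f])
    (shift_mean mu f @^-1` [set shift_mean mu f 0])); last first.
  by apply/seteqP; split => a /= aP f; exact: aP.
apply: closed_bigI => f /= cf; apply: closed_comp; last exact: closed_eq.
by move=> x _; exact: continuous_shift_mean.
Qed.

Lemma stabilizer_zmod_closed mu : zmod_closed [in stabilizer mu].
Proof.
split=> [|a b]; rewrite !inE/= => // aP bP f cf.
have cfb := continuous_shift (g := - b) cf.
transitivity (shift_mean mu (fun x => f (x - b)) 0).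
  rewrite -(aP _ cfb); apply: eq_Rintegral => x _.
  by rewrite addrA.
rewrite -(bP _ cfb); apply: eq_Rintegral => x _.
by rewrite addrK addr0.
Qed.

End stabilizer.

Theorem theorem9 (R : realType) (d : measure_display) (Omega : measurableType d)
  (P : probability Omega R) (G : topologicalZmodType)
  (cG : compact [set: G]) (mG : metrizable R G)
  (X Y : {RV P >-> borel G})
  (indep : independent_rv X Y)
  (XXY : same_distribution P X (fun w => X w + Y w)) :
  exists A : set G,
    [/\ compact A,
        zmod_closed [in A],
        P (Y @^-1` A) = 1%E &
        forall a : G, A a -> same_distribution P X (fun w => X w + a)].
Proof.
set mu := distribution P X; set nu := distribution P Y.
have clA : closed (stabilizer mu) := stabilizer_closed (mu := mu) cG.
exists (stabilizer mu); set A := stabilizer mu in clA *.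
split; [|exact: stabilizer_zmod_closed| |].
- exact: subclosed_compact clA cG _.
- have [U bU] := compact_metrizable_base_seq cG mG.
  have mA : measurable (A : set (borel G)).
    by rewrite -(setCK A); apply: measurableC; apply: open_borel; exact: closed_openC.
  have nuA : nu (~` A) = 0%E.
    apply: measure_negligible; first exact: measurableC.
    apply: negligibleS (support_negligible nu bU) => z /=.
    apply: contra_not => nuz f cf.
    rewrite -[z]add0r; apply: (harmonic_shift cG) nuz.
      exact: continuous_shift_mean.
    exact: shift_mean_harmonic.
  have := probability_setC nu (measurableC mA).
  by rewrite setCK => nuA1; apply: (etrans nuA1); rewrite [X in (1 - X)%E]nuA sube0.
move=> a Aa B mB.
pose Z : {mfun Omega >-> borel G} := HB.pack (fun w => X w + a : borel G)
  (isMeasurableFun.Build _ _ _ _ _ (sum_measurable cG mG X (cst a))).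
rewrite -[LHS]/(mu B) -[RHS]/(distribution P Z B).
apply: (probability_eq_continuous cG mG) => // f cf.
apply: (etrans _ (esym (law_Rintegral P cG Z cf))).
apply: (etrans _ (esym (law_shift_mean P cG X a cf))); rewrite Aa//.
by apply: eq_Rintegral => x _; rewrite addr0.
Qed.
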